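(* Let $X$ be a real Banach space, let $(\Omega,\Sigma,\mu)$ be a complete probability space, let $1\leq p<\infty$, and let $n$ be a positive integer. Let $Y$ be a vector subspace of $X$ which is weakly $\mathcal{K}$-analytic and $p$-simultaneously proximinal in $X$ (for $n$-tuples). Then $L_p(\mu,Y)$ is $p$-simultaneously proximinal in $L_p(\mu,X)$ (for $n$-tuples); that is, for every $f_1,\ldots,f_n\in L_p(\mu,X)$ there exists $g\in L_p(\mu,Y)$ with $$\sum_{i=1}^n\|f_i-g\|_p^p\leq \sum_{i=1}^n\|f_i-h\|_p^p\quad\text{for all } h\in L_p(\mu,Y).$$
   Context: $L_p(\mu,X)$ denotes the Banach space of (classes of) Bochner $p$-integrable functions $\Omega\to X$ with norm $\|f\|_p=(\int_\Omega\|f(s)\|^p\,d\mu(s))^{1/p}$; $L_p(\mu,Y)$ is the subspace of those taking values in $Y$. For a subset $Y$ of a normed space $X$, a finite set $A=\{a_1,\ldots,a_n\}\subset X$ and $m\in[1,\infty)$, a point $y_0\in Y$ is a relative $m$-center of $A$ in $Y$ if $\sum_{i=1}^n\|a_i-y_0\|^m\leq\sum_{i=1}^n\|a_i-y\|^m$ for all $y\in Y$. $Y$ is called $m$-simultaneously proximinal in $X$ if every $n$-tuple $a_1,\ldots,a_n\in X$ admits a relative $m$-center in $Y$. A subset $A$ of a Hausdorff space $T$ is $\mathcal{K}$-analytic if there is an upper semi-continuous map $\Psi$ from $\mathbb{N}^{\mathbb{N}}$ (product topology) to the nonempty compact subsets of $T$ with $A=\bigcup_{\sigma\in\mathbb{N}^{\mathbb{N}}}\Psi(\sigma)$;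 here upper semi-continuous means that for every $\sigma$ and every open $V\supset\Psi(\sigma)$ there is a neighborhood $U$ of $\sigma$ with $\bigcup_{u\in U}\Psi(u)\subset V$. $Y$ is weakly $\mathcal{K}$-analytic if it is $\mathcal{K}$-analytic in the weak topology of $X$. *)

(* Defs.v *)
From HB Require Import structures.
From mathcomp Require Import all_boot all_order all_algebra.
From mathcomp Require Import all_classical all_reals all_analysis.
Set Implicit Arguments. Unset Strict Implicit. Unset Printing Implicit Defensive.
Import Order.TTheory GRing.Theory Num.Theory.
Import numFieldNormedType.Exports.
Local Open Scope classical_set_scope.
Local Open Scope ring_scope.

Definition complete_measure {d} {Omega : measurableType d} {R : realType}
  (mu : set Omega -> \bar R) : Prop :=
  forall N, measurable N -> mu N = 0%E -> forall A, A `<=` N -> measurable A.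

Definition simple_fun {d} {Omega : measurableType d} {X : Type}
  (phi : Omega -> X) : Prop :=
  finite_set (range phi) /\ forall x, measurable (phi @^-1` [set x]).

Definition strongly_measurable {d} {Omega : measurableType d} {R : realType}
  {X : normedModType R} (mu : {measure set Omega -> \bar R}) (f : Omega -> X) : Prop :=
  exists phi : nat -> Omega -> X, (forall k, simple_fun (phi k)) /\
    {ae mu, forall s, (fun k => phi k s) @ \oo --> f s}.

Definition Lp_pow {d} {Omega : measurableType d} {R : realType}
  {X : normedModType R} (mu : {measure set Omega -> \bar R}) (p : R)
  (f : Omega -> X) : \bar R :=
  (\int[mu]_s ((`|f s| `^ p)%:E))%E.

(* (representatives of) Bochner p-integrable functions Omega -> X *)
Definition in_Lp {d} {Omega : measurableType d} {R : realType}
  {X : normedModType R} (mu : {measure set Omega -> \bar R}) (p : R)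
  (f : Omega -> X) : Prop :=
  strongly_measurable mu f /\ (Lp_pow mu p f < +oo)%E.

Definition in_LpY {d} {Omega : measurableType d} {R : realType}
  {X : normedModType R} (mu : {measure set Omega -> \bar R}) (p : R)
  (Y : set X) (f : Omega -> X) : Prop :=
  in_Lp mu p f /\ forall s, Y (f s).

Definition vector_subspace {R : realType} {X : normedModType R} (Y : set X) : Prop :=
  Y 0 /\ forall (a : R) x y, Y x -> Y y -> Y (a *: x + y).

Definition simul_proximinal {R : realType} {X : normedModType R}
  (m : R) (n : nat) (Y : set X) : Prop :=
  forall a : 'I_n -> X, exists2 y0, Y y0 &
    forall y, Y y -> \sum_(i < n) `|a i - y0| `^ m <= \sum_(i < n) `|a i - y| `^ m.

Definition cont_linear_functional {R : realType} {X : normedModType R}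
  (phi : X -> R) : Prop :=
  (forall (a : R) x y, phi (a *: x + y) = a * phi x + phi y) /\ continuous phi.

Definition weakly_open {R : realType} {X : normedModType R} (V : set X) : Prop :=
  forall x, V x -> exists (k : nat) (phi : 'I_k -> X -> R) (e : R),
    [/\ forall j, cont_linear_functional (phi j), 0 < e &
        [set y | forall j, `|phi j y - phi j x| < e] `<=` V].

Definition weakly_compact {R : realType} {X : normedModType R} (K : set X) : Prop :=
  forall (I : Type) (F : I -> set X), (forall i, weakly_open (F i)) ->
    K `<=` \bigcup_i F i ->
    exists J : set I, finite_set J /\ K `<=` \bigcup_(i in J) F i.

(* the Baire space N^N with the product topology (N discrete): the basic
   neighbourhoods of sigma are the sets of u agreeing with sigma below m *)
Definition usc_map {R : realType} {X : normedModType R}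
  (Psi : (nat -> nat) -> set X) : Prop :=
  forall (sigma : nat -> nat) (V : set X), weakly_open V -> Psi sigma `<=` V ->
    exists m : nat, forall u : nat -> nat, (forall k, (k < m)%N -> u k = sigma k) ->
      Psi u `<=` V.

Definition weakly_K_analytic {R : realType} {X : normedModType R} (Y : set X) : Prop :=
  exists Psi : (nat -> nat) -> set X,
    [/\ forall sigma, Psi sigma !=set0 /\ weakly_compact (Psi sigma),
        usc_map Psi &
        Y = \bigcup_sigma Psi sigma].

(* Main.v *)
Require Import Defs.
From HB Require Import structures.
From mathcomp Require Import all_boot all_order all_algebra.
From mathcomp Require Import all_classical all_reals all_analysis.
From mathcomp Require Import measurable_realfun.
From mathcomp Require Import lra.
Import Order.TTheory GRing.Theory Num.Theory.
Import numFieldNormedType.Exports.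
Local Open Scope classical_set_scope.
Local Open Scope ring_scope.

(* Let [Psi] be the upper semicontinuous map presenting [Y]. A compact box
   [prod_i {0, ..., k i}] of the Baire space has a weakly compact image [W] under [Psi],
   and since norm-closed balls are weakly closed, the tuples having a relative center in
   [W] form a norm-closed set; so do those having one in [W] and in finitely many given
   closed balls. A capacity argument on the boxes shows that for almost every [s] the
   tuple [(f_1 s, ..., f_n s)] has a center in the image of one of countably many boxes.
   The tuples of a given box form a separable set, so countably many centers are dense
   enough to replace [W] by its intersection with a separable, weakly closed subspace.
   A Kuratowski-Ryll-Nardzewski selection by shrinking closed balls then yields a
   strongly measurable [g] with [g s] a center of [(f_1 s, ..., f_n s)], and such a [g]
   minimizes the integral because it minimizes the integrand pointwise. *)

Set Implicit Arguments.
Unset Strict Implicit.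
Unset Printing Implicit Defensive.

(** * The Hahn-Banach theorem *)

(** Only one inequality is asked for positive scalars, which is what an infimum readily satisfies;
    scaling back by the inverse gives equality. *)
Definition sublinear {R : realType} {X : lmodType R} (q : X -> R) : Prop :=
  (forall x y, q (x + y) <= q x + q y) /\
  (forall t x, 0 < t -> q (t *: x) <= t * q x).

Lemma sublinearZ {R : realType} {X : lmodType R} (q : X -> R) t x :
  sublinear q -> 0 < t -> q (t *: x) = t * q x.
Proof.
move=> [_ qZ] t0; apply/eqP; rewrite eq_le qZ //=.
have ti : 0 < t^-1 by rewrite invr_gt0.
have := qZ _ (t *: x) ti.
by rewrite scalerA mulVf ?gt_eqF // scale1r ler_pdivlMl.
Qed.

Lemma sublinear0 {R : realType} {X : lmodType R} (q : X -> R) :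
  sublinear q -> q 0 = 0.
Proof.
move=> sq; have := sublinearZ (0 : X) sq (ltr0Sn R 1); rewrite scaler0; lra.
Qed.

Lemma sublinear_ge {R : realType} {X : lmodType R} (q : X -> R) x :
  sublinear q -> - q (- x) <= q x.
Proof. by move=> sq; have := sq.1 x (- x); rewrite subrr sublinear0 //; lra. Qed.

(** The index may change from one side to the other, so that the lemma serves for shifted slopes,
    for chains of functionals and for the distance to a subspace. *)
Lemma inf_sublinear {R : realType} {X : lmodType R} (I : Type) (D : set I)
    (P : I -> X -> R) :
  D !=set0 -> (forall x, has_lbound [set P i x | i in D]) ->
  (forall i j x y, D i -> D j -> exists2 k, D k & P k (x + y) <= P i x + P j y) ->
  (forall i t x, D i -> 0 < t -> exists2 k, D k & P k (t *: x) <= t * P i x) ->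
  sublinear (fun x => inf [set P i x | i in D]).
Proof.
move=> [i0 Di0] lb PD PZ.
have ne x : [set P i x | i in D] !=set0 by exists (P i0 x); exists i0.
split=> [x y|t x t0].
- rewrite -lerBlDr; apply: lb_le_inf => //= _ [i Di <-].
  rewrite lerBlDr -lerBlDl; apply: lb_le_inf => //= _ [j Dj <-].
  rewrite lerBlDl; have [k Dk] := PD i j x y Di Dj.
  by apply: le_trans; apply: ge_inf => //; exists k.
- rewrite -ler_pdivrMl //; apply: lb_le_inf => //= _ [i Di <-].
  rewrite ler_pdivrMl //; have [k Dk] := PZ i t x Di t0.
  by apply: le_trans; apply: ge_inf => //; exists k.
Qed.

(** The usual device for making [q] linear along [x]: [t = 0] shows that it lies below [q], and
    [t = 1] that its value at [- x] is at most [- q x]. *)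
Definition shift_slope {R : realType} {X : lmodType R} (q : X -> R) (x y : X) : R :=
  inf [set q (y + t *: x) - t * q x | t in [set t | 0 <= t]].

Lemma shift_slope_lbound {R : realType} {X : lmodType R} (q : X -> R) (x y : X) :
  sublinear q -> has_lbound [set q (y + t *: x) - t * q x | t in [set t | 0 <= t]].
Proof.
move=> sq; exists (- q (- y)) => _ [t /= t0 <-].
case: (ltgtP 0 t) t0 => // [t0 _|<- _]; last first.
  by rewrite scale0r addr0 mul0r subr0; exact: sublinear_ge.
rewrite -(sublinearZ x sq t0); have := sq.1 (y + t *: x) (- y).
by rewrite addrAC subrr add0r; lra.
Qed.

Lemma shift_slope_sublinear {R : realType} {X : lmodType R} (q : X -> R) (x : X) :
  sublinear q -> sublinear (shift_slope q x).
Proof.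
move=> sq; apply: (@inf_sublinear R X R [set t | 0 <= t]
  (fun t y => q (y + t *: x) - t * q x)).
- by exists 0 => /=.
- by move=> y; exact: shift_slope_lbound.
- move=> s t y z /= s0 t0; exists (s + t); first exact: addr_ge0.
  have -> : y + z + (s + t) *: x = (y + s *: x) + (z + t *: x).
    by rewrite scalerDl addrACA.
  by have := sq.1 (y + s *: x) (z + t *: x); rewrite mulrDl; lra.
- move=> s t y /= s0 t0; exists (t * s); first by rewrite mulr_ge0 // ltW.
  have -> : t *: y + (t * s) *: x = t *: (y + s *: x).
    by rewrite scalerDr scalerA.
  by rewrite (sublinearZ _ sq t0) mulrBr mulrA.
Qed.

Lemma shift_slope_le {R : realType} {X : lmodType R} (q : X -> R) (x y : X) t :
  sublinear q -> 0 <= t -> shift_slope q x y <= q (y + t *: x) - t * q x.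
Proof.
by move=> sq t0; apply: ge_inf; [exact: shift_slope_lbound|exists t].
Qed.

(* A pointwise minimal sublinear functional [p] agrees with [shift_slope p x] for
   every [x], which forces it to be additive. *)
Lemma minimal_sublinear {R : realType} {X : lmodType R} (q : X -> R) :
  sublinear q -> exists p : X -> R, [/\ sublinear p, forall x, p x <= q x &
    forall r, sublinear r -> (forall x, r x <= p x) -> r = p].
Proof.
move=> sq.
pose T := {p : X -> R | sublinear p /\ forall x, p x <= q x}.
(* The order is reversed, so that a maximal element for Zorn's lemma is a minimal functional. *)
pose Rl (f g : T) := `[< forall x, sval g x <= sval f x >].
have [||||p pmin] := @Zorn T Rl.
- by move=> t; apply/asboolP.
- move=> r s t /asboolP rs /asboolP st; apply/asboolP => x.
  exact: le_trans (st x) (rs x).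
- move=> [s sP] [t tP] /asboolP /= st /asboolP /= ts.
  have est : s = t by apply/funext => x; apply/eqP; rewrite eq_le st ts.
  by subst t; congr exist; exact: Prop_irrelevance.
- move=> A totA; have [[a Aa]|A0] := pselect (A !=set0); last first.
    exists (exist _ q (conj sq (fun x => lexx (q x)))) => s As.
    by exfalso; apply: A0; exists s.
  have lb x : has_lbound [set sval i x | i in A].
    exists (- q (- x)) => _ [i _ <-].
    have [si iq] := svalP i; apply: le_trans (sublinear_ge x si).
    by rewrite lerN2 iq.
  pose r x := inf [set sval i x | i in A].
  have sr : sublinear r.
    apply: (@inf_sublinear R X T A (fun i => sval i)) => //; first by exists a.
    + move=> i j x y Ai Aj; have [/asboolP ij|/asboolP ji] := totA i j Ai Aj.
      * exists j => //; apply: le_trans ((svalP j).1.1 x y) _.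
        by rewrite lerD2r ij.
      * exists i => //; apply: le_trans ((svalP i).1.1 x y) _.
        by rewrite lerD2l ji.
    + by move=> i t x Ai t0; exists i => //; exact: (svalP i).1.2.
  have rA i x : A i -> r x <= sval i x by move=> Ai; apply: ge_inf => //; exists i.
  exists (exist _ r (conj sr (fun x => le_trans (rA a x Aa) ((svalP a).2 x)))).
  by move=> s As; apply/asboolP => x /=; exact: rA.
- exists (sval p); have [sp pq] := svalP p; split=> // r sr rp.
  pose rT : T := exist _ r (conj sr (fun x => le_trans (rp x) (pq x))).
  have := pmin rT; rewrite /Rl /rT /= => h.
  by rewrite -h //; apply/asboolP.
Qed.

(** Minimality is taken below [shift_slope q x0] instead of [q]: this forces [phi (- x0) <= - q x0],
    hence equality at [x0] once [phi] is known to be linear. *)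
Lemma hahn_banach_point {R : realType} {X : lmodType R} (q : X -> R) (x0 : X) :
  sublinear q -> exists phi : X -> R,
    [/\ forall (a : R) x y, phi (a *: x + y) = a * phi x + phi y,
        forall x, phi x <= q x & phi x0 = q x0].
Proof.
move=> sq.
have [p [sp pq pmin]] := minimal_sublinear (shift_slope_sublinear x0 sq).
have pS x : shift_slope p x = p.
  apply: pmin; first exact: shift_slope_sublinear.
  by move=> y; have := shift_slope_le x y sp (lexx _); rewrite scale0r addr0 mul0r subr0.
have pD x y : p (x + y) = p x + p y.
  apply/eqP; rewrite eq_le sp.1 /=.
  by have := shift_slope_le y x sp ler01; rewrite pS scale1r mul1r; lra.
have pN x : p (- x) = - p x.
  by have := pD x (- x); rewrite subrr sublinear0 //; lra.
have pZ a x : p (a *: x) = a * p x.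
  have [a0|a0|->] := ltgtP a 0; last by rewrite scale0r mul0r sublinear0.
  - by rewrite -[a]opprK scaleNr pN sublinearZ ?oppr_gt0 // !mulNr.
  - exact: sublinearZ.
have pleq x : p x <= q x.
  apply: le_trans (pq x) _.
  by have := shift_slope_le x0 x sq (lexx _); rewrite scale0r addr0 mul0r subr0.
exists p; split=> // [a x y|]; first by rewrite pD pZ.
apply/eqP; rewrite eq_le pleq /=.
have := pq (- x0); have := shift_slope_le x0 (- x0) sq ler01.
by rewrite pN scale1r addNr sublinear0 // mul1r; lra.
Qed.

Lemma hahn_banach_normed {R : realType} {X : normedModType R} (q : X -> R) (x0 : X) :
  sublinear q -> (forall x, q x <= `|x|) -> exists phi : X -> R,
    [/\ cont_linear_functional phi, forall x, phi x <= q x & phi x0 = q x0].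
Proof.
move=> sq qn; have [phi [lin phiq phi0]] := hahn_banach_point x0 sq.
exists phi; split=> //; split=> // x.
have phiB y z : phi (y - z) = phi y - phi z.
  by rewrite [y - z]addrC -scaleN1r lin mulN1r addrC.
apply/cvgrPdist_lt => e e0; near=> y.
have xy : `|x - y| < e by near: y; exact: cvgr_dist_lt.
rewrite -phiB; apply: le_lt_trans xy; rewrite ler_norml.
have := le_trans (phiq (y - x)) (qn _); rewrite distrC (phiB y x) => h1.
have := le_trans (phiq (x - y)) (qn _); rewrite (phiB x y) => h2.
by apply/andP; split; lra.
Unshelve. all: by end_near. Qed.

(** * Weakly open sets *)

(** Truncating at [0] keeps the power continuous and monotone on the whole line, since distances
    will be shifted by negative amounts. At [0] the radius [e^(1/p)] works. *)
Lemma pos_powR_continuous {R : realType} (p : R) : 0 < p ->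
  continuous (fun t : R => Num.max t 0 `^ p).
Proof.
move=> p0 x; have [x0|x0|->] := ltgtP x 0.
- apply: (@cvg_trans _ ((fun=> 0 `^ p) @ x)).
    apply: near_eq_cvg; near=> t.
    have t0 : t < 0 by near: t; exact: lt_nbhsl.
    by rewrite max_r // ltW.
  by rewrite (max_r (ltW x0)); exact: (@cvg_cst R (0 `^ p) R (nbhs (x : R)) _).
- apply: (@cvg_trans _ ((fun t => expR (p * ln t)) @ x)).
    apply: near_eq_cvg; near=> t.
    have t0 : 0 < t by near: t; exact: lt_nbhsr.
    by rewrite max_l ?(ltW t0) // /powR gt_eqF.
  rewrite max_l ?(ltW x0) // /powR gt_eqF //.
  apply: (@cvg_comp _ _ _ (fun t => p * ln t) expR _ (nbhs (p * ln x)));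
    last exact: continuous_expR.
  by apply: cvgM; [exact: cvg_cst|exact: continuous_ln].
- rewrite /continuous_at maxxx powR0 ?gt_eqF //; apply/cvgrPdist_lt => e e0.
  have d0 : 0 < e `^ p^-1 by rewrite powR_gt0.
  near=> t; rewrite sub0r normrN ger0_norm ?powR_ge0 //.
  have -> : e = (e `^ p^-1) `^ p by rewrite -powRrM mulVf ?gt_eqF // powRr1 // ltW.
  apply: gt0_ltr_powR => //; rewrite ?nnegrE ?powR_ge0 ?le_max ?lexx ?orbT //.
  by rewrite gt_max d0 andbT; near: t; exact: (lt_nbhsl d0).
Unshelve. all: by end_near. Qed.

(* At [t = 0] this is the function of [y] minimized by a relative center of [x]. *)
Definition shifted_sum {R : realType} {X : normedModType R} (p : R) n
    (x : 'I_n -> X) (y : X) (t : R) : R :=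
  \sum_(i < n) Num.max (`|x i - y| + t) 0 `^ p.

Section ShiftedSum.
Context {R : realType} {X : normedModType R} (p : R) (n : nat).
Hypothesis p0 : 0 < p.
Implicit Types (x : 'I_n -> X) (y : X).

Lemma shifted_sum0 x y : shifted_sum p x y 0 = \sum_(i < n) `|x i - y| `^ p.
Proof. by apply: eq_bigr => i _; rewrite addr0 max_l. Qed.

Lemma le_shifted_sum x x' y y' t t' :
  (forall i, `|x i - y| + t <= `|x' i - y'| + t') ->
  shifted_sum p x y t <= shifted_sum p x' y' t'.
Proof.
move=> h; apply: ler_sum => i _; apply: ge0_ler_powR; first exact: ltW.
- by rewrite nnegrE le_max lexx orbT.
- by rewrite nnegrE le_max lexx orbT.
- by rewrite ge_max !le_max h lexx orbT.
Qed.

Lemma shifted_sum_continuous x y : continuous (shifted_sum p x y).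
Proof.
move=> t; apply: cvg_big => [|i _]; first exact: add_continuous.
apply: (@cvg_comp _ _ _ (fun t => `|x i - y| + t) (fun t : R => Num.max t 0 `^ p) _
  (nbhs (`|x i - y| + t))); last exact: pos_powR_continuous.
by apply: cvgD; [exact: cvg_cst|exact: cvg_id].
Qed.

Lemma shifted_sum_gtB x y t c : c < shifted_sum p x y t ->
  exists2 e, 0 < e & c < shifted_sum p x y (t - e).
Proof.
move=> h; have /cvgr_gt/(_ _ h) := @shifted_sum_continuous x y t.
move=> /nbhs_ballP[e /= e0 he]; exists (e / 2); first by rewrite divr_gt0.
by apply: he; rewrite /ball /= opprB addrC subrK gtr0_norm ?divr_gt0 //; lra.
Qed.

(** Both sides are compared with their midpoint [c]. The gap thus survives raising the distances to
    [y] and lowering those to [z] by a small amount, which absorbs a small change of the tuple. *)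
Lemma shifted_sum_lt_near x y z :
  shifted_sum p x y 0 < shifted_sum p x z 0 ->
  exists m, forall k, (m <= k)%N ->
    shifted_sum p x y k.+1%:R^-1 < shifted_sum p x z (- k.+1%:R^-1).
Proof.
move=> h; pose c := (shifted_sum p x y 0 + shifted_sum p x z 0) / 2.
have h1 : shifted_sum p x y 0 < c by rewrite /c; lra.
have h2 : c < shifted_sum p x z 0 by rewrite /c; lra.
have /cvgr_lt/(_ _ h1)/nbhs_ballP[e1 /= e10 H1] := @shifted_sum_continuous x y 0.
have /cvgr_gt/(_ _ h2)/nbhs_ballP[e2 /= e20 H2] := @shifted_sum_continuous x z 0.
have e0 : 0 < Num.min e1 e2 by rewrite lt_min e10.
have /cvgrPdist_lt/(_ _ e0) := @cvg_harmonic R.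
move=> [m _ hm]; exists m => k mk.
have := hm k mk; rewrite /= /harmonic sub0r normrN gtr0_norm ?invr_gt0 //.
rewrite lt_min => /andP[k1 k2]; apply: (@lt_trans _ _ c).
- by apply: H1; rewrite /ball /= sub0r normrN gtr0_norm ?invr_gt0.
- by apply: H2; rewrite /ball /= sub0r opprK gtr0_norm ?invr_gt0.
Qed.

End ShiftedSum.

Section WeakTopology.
Context {R : realType} {X : normedModType R}.

Lemma weakly_openU (U V : set X) :
  weakly_open U -> weakly_open V -> weakly_open (U `|` V).
Proof.
move=> oU oV x [/oU|/oV] [k [phi [e [lin e0 sub]]]];
  exists k, phi, e; split=> // y /sub; by [left|right].
Qed.

(** A functional norming [y - z] gives a quantitative form of the weak lower semicontinuity of the
    norm. *)
Lemma norm_weak_nbhs (y z : X) : exists2 phi : X -> R, cont_linear_functional phi &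
  forall y', `|z - y| - `|phi y' - phi y| <= `|z - y'|.
Proof.
have sn : @sublinear R X (fun v => `|v|).
  split=> [u v|t v t0]; first exact: ler_normD.
  by rewrite normrZ gtr0_norm.
have [phi [cphi le phi0]] := hahn_banach_normed (y - z) sn (fun=> lexx _).
exists phi => // y'; have lin := cphi.1.
have phiB u v : phi (u - v) = phi u - phi v.
  by rewrite addrC -scaleN1r lin mulN1r addrC.
have h1 := le (y' - z); have h2 := ler_norm (phi y - phi y').
rewrite phiB in h1; rewrite distrC in h2.
by rewrite (distrC z y) (distrC z y') -phi0 phiB; lra.
Qed.

Lemma weakly_open_shifted_sum (p : R) n (x : 'I_n -> X) t c : 0 < p ->
  weakly_open [set y | c < shifted_sum p x y t].
Proof.
move=> p0 y /= /(shifted_sum_gtB p0)[e e0 he].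
have /choice[phi hphi] : forall i, exists phi : X -> R, cont_linear_functional phi /\
    forall y', `|x i - y| - `|phi y' - phi y| <= `|x i - y'|.
  by move=> i; have [phi] := norm_weak_nbhs y (x i); exists phi.
exists n, phi, e; split=> // [i|y' /= hy']; first exact: (hphi i).1.
apply: lt_le_trans he _; apply: le_shifted_sum => // i.
by have := (hphi i).2 y'; have := hy' i; lra.
Qed.

Lemma weakly_open_setC_ball (z : X) (r : R) :
  weakly_open (~` [set y | `|z - y| <= r]).
Proof.
move=> y /= /negP; rewrite -ltNge => hr.
have [phi cphi hphi] := norm_weak_nbhs y z.
exists 1%N, (fun=> phi), (`|z - y| - r); split=> //; first by rewrite subr_gt0.
move=> y' /= /(_ ord0) hy' h; have := hphi y'; lra.
Qed.

(** The distance to [Z] is sublinear and dominated by the norm. Hahn-Banach applied to it separates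
    [x] from [Z]: the functional is nonpositive on [Z] and positive at [x]. *)
Lemma weakly_open_setC_subspace (Z : set X) : vector_subspace Z ->
  (forall x, (forall e, 0 < e -> exists2 z, Z z & `|x - z| < e) -> Z x) ->
  weakly_open (~` Z).
Proof.
move=> [Z0 Zlin] Zcl x /= nZx.
pose dist y := inf [set `|y - z| | z in Z].
have lb y : has_lbound [set `|y - z| | z in Z] by exists 0 => _ [z _ <-].
have dist_le y z : Z z -> dist y <= `|y - z|.
  by move=> Zz; apply: ge_inf => //; exists z.
have sdist : sublinear dist.
  apply: (@inf_sublinear R X X Z (fun z y => `|y - z|)) => //; first by exists 0.
  - move=> z z' y y' Zz Zz'; exists (z + z').
      by have := Zlin 1 z z' Zz Zz'; rewrite scale1r.
    by rewrite opprD addrACA ler_normD.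
  - move=> z t y Zz t0; exists (t *: z).
      by have := Zlin t z 0 Zz Z0; rewrite addr0.
    by rewrite -scalerBr normrZ gtr0_norm.
have distZ z : Z z -> dist z <= 0.
  by move=> Zz; have := dist_le z z Zz; rewrite subrr normr0.
have distx : 0 < dist x.
  rewrite ltNge; apply/negP => dx; apply: nZx; apply: Zcl => e e0.
  have hinf : has_inf [set `|x - z| | z in Z] by split => //; exists `|x - 0|, 0.
  have [_ [z Zz <-] hz] := inf_adherent e0 hinf.
  by exists z => //; move: hz dx; rewrite /dist; lra.
have [phi [cphi le phi0]] := hahn_banach_normed x sdist
  (fun y => le_trans (dist_le y 0 Z0) (eq_ind_r (fun u => `|u| <= `|y|) (lexx _) (subr0 y))).
exists 1%N, (fun=> phi), (dist x); split=> // y /= /(_ ord0) hy Zy.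
have := le y; have := distZ y Zy; move: hy; rewrite phi0 distrC.
have := ler_norm (dist x - phi y). lra.
Qed.

End WeakTopology.

(** * Compactness in the Baire space *)

Lemma seq_dependent_choice (P : seq nat -> Prop) :
  P [::] -> (forall t, P t -> exists j, P (rcons t j)) ->
  exists s : nat -> nat, forall m, P (mkseq s m).
Proof.
move=> P0 PS.
have /choice[f hf] : forall t, exists j, P t -> P (rcons t j).
  move=> t; have [Pt|nPt] := pselect (P t); last by exists 0%N.
  by have [j] := PS t Pt; exists j.
pose T m := iter m (fun t => rcons t (f t)) [::].
exists (fun m => f (T m)) => m.
have E : mkseq (fun m => f (T m)) m = T m.
  by elim: m => // m IHm; rewrite mkseqS IHm.
by rewrite E; elim: m {E} => [|m IHm]; [exact: P0|exact: hf].
Qed.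

(* Compactness of the box [prod_i {0, ..., k i}], in the form of an induction principle
   over its coverings by cylinders. *)
Lemma box_induction (k : nat -> nat) (H : set (nat -> nat) -> Prop) :
  H set0 -> (forall A B, A `<=` B -> H B -> H A) ->
  (forall A B, H A -> H B -> H (A `|` B)) ->
  (forall s, (forall i, s i <= k i)%N ->
    exists m, H [set u | forall i, (i < m)%N -> u i = s i]) ->
  exists M, H [set u | forall i, (i < M)%N -> (u i <= k i)%N].
Proof.
move=> H0 HS HU Hloc; apply: contrapT => nH.
pose box t M := [set u : nat -> nat | (forall i, (i < size t)%N -> u i = nth 0%N t i) /\
  forall i, (i < M)%N -> (u i <= k i)%N].
(* A prefix is bad if [H] fails on every truncated box above it. A bad prefix has a bad extension,
   since otherwise finitely many good boxes cover a box above it; an infinite bad branch contradicts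
   the local hypothesis. *)
pose P t := (forall i, (i < size t)%N -> (nth 0%N t i <= k i)%N) /\
  forall M, ~ H (box t M).
have [||s hs] := @seq_dependent_choice P.
- by split=> // M HM; apply: nH; exists M; apply: HS HM => u hu; split.
- move=> t [tk nt]; apply: contrapT => nj.
  have hM j : exists M, (j <= k (size t))%N -> H (box (rcons t j) M).
    have [jk|jk] := pselect (j <= k (size t))%N; last by exists 0%N.
    apply: contrapT => nM; apply: nj; exists j; split.
      move=> i; rewrite size_rcons ltnS nth_rcons leq_eqVlt.
      by case: ltngtP => //= [it _|-> _]; [exact: tk|].
    by move=> M HM; apply: nM; exists M.
  have [Mf hMf] := choice hM.
  have HJ J : (J <= (k (size t)).+1)%N ->
      H (\bigcup_(j in [set j | (j < J)%N]) box (rcons t j) (Mf j)).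
    elim: J => [_|J IHJ JK].
      by apply: HS H0 => u [].
    apply: HS (HU _ _ (IHJ (ltnW JK)) (hMf J JK)) => u [j /=].
    by rewrite ltnS leq_eqVlt => /orP[/eqP->|jJ] hu; [right|left; exists j].
  (* The truncation must bound coordinate [size t], so that finitely many extensions remain, and be
     at least every [Mf j] used for them. *)
  apply: (nt (maxn (size t).+1 (\max_(j < (k (size t)).+1) Mf j))).
  apply: HS (HJ _ (leqnn _)) => u [ut uk].
  have ukt : (u (size t) <= k (size t))%N by apply: uk; rewrite leq_max ltnSn.
  exists (u (size t)) => //; split=> [i|i iM].
    rewrite size_rcons ltnS nth_rcons leq_eqVlt.
    by case: ltngtP => //= [it _|-> _]; [exact: ut|].
  apply: uk; rewrite leq_max; apply/orP; right; apply: leq_trans iM _.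
  by apply: (leq_bigmax (Ordinal (ukt : (u (size t) < (k (size t)).+1)%N))).
- have sk i : (s i <= k i)%N.
    by have := (hs i.+1).1 i; rewrite size_mkseq nth_mkseq // => ->.
  have [m Hm] := Hloc s sk.
  apply: ((hs m).2 0%N); apply: HS Hm => u [hu _] /= i im.
  by rewrite hu ?size_mkseq // nth_mkseq.
Qed.

(** * Limits of tuples having centers in a compact part *)

Definition centers {R : realType} {X : normedModType R} (p : R) n (Y : set X)
    (x : 'I_n -> X) : set X :=
  [set y | Y y /\ forall z, Y z -> shifted_sum p x y 0 <= shifted_sum p x z 0].

(** [K] restricts the index in the Baire space and is truncated in compactness arguments; [C]
    carries the weakly closed constraints on the center itself. *)
Definition centered {R : realType} {X : normedModType R} (p : R) n (Y : set X)
    (Psi : (nat -> nat) -> set X) (K : set (nat -> nat)) (C : set X) :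
    set ('I_n -> X) :=
  [set x | exists u y, [/\ K u, Psi u y, C y & centers p Y x y]].

(** If [x] had no center as required, weakly open sets [V j] of points that are visibly worse than a
    true center [y0], or outside [C], would cover each [Psi s]. By compactness one [V j] contains
    the image of a truncated box, which a close enough [x'] contradicts. Hence the approximants need
    only obey finitely many bounds. *)
Lemma centered_limit {R : realType} {X : normedModType R} (p : R) n (Y : set X)
    (Psi : (nat -> nat) -> set X) (k : nat -> nat) (C : set X) (x : 'I_n -> X) :
  0 < p -> (forall s, weakly_compact (Psi s)) -> usc_map Psi ->
  (forall s, Psi s `<=` Y) -> weakly_open (~` C) -> centers p Y x !=set0 ->
  (forall M e, 0 < e -> exists2 x', (forall i, `|x i - x' i| < e) &
    centered p Y Psi [set u | forall i, (i < M)%N -> (u i <= k i)%N] C x') ->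
  centered p Y Psi [set u | forall i, (u i <= k i)%N] C x.
Proof.
move=> p0 cpt usc PsiY oC [y0 [Yy0 y0min]] near; apply: contrapT => nx.
pose V (j : nat) : set X := ~` C `|`
  [set y | shifted_sum p x y0 j.+1%:R^-1 < shifted_sum p x y (- j.+1%:R^-1)].
have oV j : weakly_open (V j).
  by apply: weakly_openU => //; exact: weakly_open_shifted_sum.
have Vmono j j' : (j <= j')%N -> V j `<=` V j'.
  move=> jj' y [|/= h]; [by left|right => /=].
  have jj : j'.+1%:R^-1 <= j.+1%:R^-1 :> R.
    by rewrite lef_pV2 ?posrE // ler_nat.
  apply: (le_lt_trans (le_shifted_sum p0 _)); last apply: (lt_le_trans h).
    by move=> i; rewrite lerD2l.
  by apply: le_shifted_sum => // i; rewrite lerD2l lerN2.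
have [|||s sk|M [j hj]] := @box_induction k
    (fun S => exists j, forall u, S u -> Psi u `<=` V j).
- by exists 0%N.
- by move=> A B AB [j hj]; exists j => u /AB; exact: hj.
- move=> A B [j hj] [j' hj']; exists (maxn j j') => u [/hj h|/hj' h];
    apply: subset_trans h _; apply: Vmono; [exact: leq_maxl|exact: leq_maxr].
- have cov : Psi s `<=` \bigcup_j V j.
    move=> y sy; have [Cy|nCy] := pselect (C y); last by exists 0%N => //; left.
    have h : shifted_sum p x y0 0 < shifted_sum p x y 0.
      rewrite ltNge; apply/negP => le0; apply: nx; exists s, y; split=> //.
      split; first exact: PsiY sy.
      by move=> z Yz; apply: le_trans le0 _; exact: y0min.
    have [m hm] := shifted_sum_lt_near p0 h.
    by exists m => //; right; exact: hm.
  have [J [finJ hJ]] := cpt s nat V oV cov.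
  have [b hb] : exists b, forall j, J j -> (j <= b)%N.
    move/finite_seqP : finJ => [r ->]; exists (\max_(i <- r) i) => j /= jr.
    exact: leq_bigmax_seq.
  have sV : Psi s `<=` V b by move=> y /hJ[j /hb jb]; exact: Vmono.
  have [m hm] := usc s (V b) (oV b) sV.
  by exists m, b => u hu; exact: hm.
- have [x' xx' [u [y [uk uy Cy [Yy ymin]]]]] := near M j.+1%:R^-1 (ltac:(by rewrite invr_gt0)).
  have [//|/= h] := hj u uk y uy.
  (* Moving from [x] to [x'] costs less than the shift [1/(j+1)] in each distance, so membership of
     [y] in [V j] would make [y] worse than [y0] for [x'] as well. *)
  have := lt_le_trans h (le_trans (le_shifted_sum p0 (y' := y) (x' := x') (t' := 0) _) (ymin y0 Yy0)).
  rewrite ltNge => /(_ _)/negP; apply.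
    move=> i; have := ler_distD (x' i) (x i) y; have := xx' i; move: (_^-1) => e; lra.
  apply: le_shifted_sum => // i; rewrite addr0.
  have := ler_distD (x i) (x' i) y0; have := xx' i; rewrite [`|x' i - x i|]distrC; move: (_^-1) => e; lra.
Qed.

(** * Measurability of closed conditions *)

Section CountableQuantifiers.
Context {d} {T : measurableType d}.

Lemma measurable_exists (I : countType) (P : I -> set T) :
  (forall i, measurable (P i)) -> measurable [set s | exists i, P i s].
Proof.
move=> mP; have -> : [set s | exists i, P i s] = \bigcup_i P i.
  by apply/seteqP; split=> s [i]; [exists i|move=> _; exists i].
by apply: countable_bigcupT_measurable => //; exact: countableP.
Qed.

Lemma measurable_forall (I : countType) (P : I -> set T) :
  (forall i, measurable (P i)) -> measurable [set s | forall i, P i s].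
Proof.
move=> mP; have -> : [set s | forall i, P i s] = ~` [set s | exists i, (~` P i) s].
  apply/seteqP; split=> s /=; first by move=> h [i]; apply.
  by move=> h i; apply: contrapT => nP; apply: h; exists i.
apply: measurableC; apply: (@measurable_exists _ (fun i => ~` P i)) => i.
exact: measurableC.
Qed.

Lemma measurable_implies (Q : Prop) (A : set T) :
  (Q -> measurable A) -> measurable [set s | Q -> A s].
Proof.
have [q /(_ q) mA|nq _] := pselect Q.
  suff -> : [set s | Q -> A s] = A by [].
  by apply/seteqP; split=> s /=; [apply|].
suff -> : [set s | Q -> A s] = setT by exact: measurableT.
by apply/seteqP; split=> // s _ /nq.
Qed.

Lemma measurable_const (Q : Prop) : measurable [set s : T | Q].
Proof.
have [q|nq] := pselect Q.
  suff -> : [set s : T | Q] = setT by exact: measurableT.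
  by apply/seteqP; split.
suff -> : [set s : T | Q] = set0 by exact: measurable0.
by apply/seteqP; split.
Qed.

End CountableQuantifiers.

Section StronglyMeasurableTuples.
Context {d} {Omega : measurableType d} {R : realType} {X : normedModType R} {n : nat}.

(** [E] is arbitrary because the tuple takes finitely many values; [v t] decodes a tuple of
    positions in the lists of values. *)
Lemma measurable_simple_tuple (phi : 'I_n -> Omega -> X) (E : set ('I_n -> X)) :
  (forall i, simple_fun (phi i)) -> measurable [set s | E (phi ^~ s)].
Proof.
move=> sphi.
have /choice[r hr] : forall i, exists r : seq X, range (phi i) = [set` r].
  by move=> i; have [/finite_seqP] := sphi i.
pose v (t : {ffun 'I_n -> nat}) (i : 'I_n) : X := nth 0 (r i) (t i).
have -> : [set s | E (phi ^~ s)] =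
    [set s | exists t, [set s | E (v t)] s /\ [set s | forall i, phi i s = v t i] s].
  apply/seteqP; split=> s /=; last first.
    by move=> [t [Et /funext st]]; rewrite st.
  move=> Es; pose t := [ffun i => index (phi i s) (r i)].
  have vt : v t = phi ^~ s.
    apply/funext => i; rewrite /v ffunE nth_index //.
    have : range (phi i) (phi i s) by exists s.
    by rewrite hr.
  by exists t; rewrite vt.
apply: measurable_exists => t; apply: measurableI; first exact: measurable_const.
by apply: measurable_forall => i; exact: (sphi i).2.
Qed.

Context (mu : {measure set Omega -> \bar R}).

Lemma strongly_measurable_tuple (f : 'I_n -> Omega -> X) :
  (forall i, strongly_measurable mu (f i)) ->
  exists (phi : nat -> 'I_n -> Omega -> X) (N : set Omega),
    [/\ forall k i, simple_fun (phi k i), measurable N, mu N = 0%E &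
        forall s, ~ N s -> forall e, 0 < e -> exists K, forall k, (K <= k)%N ->
          forall i, `|f i s - phi k i s| < e].
Proof.
move=> /choice[phi hphi].
have /choice[N hN] : forall i, exists N, [/\ measurable N, mu N = 0%E &
    ~` [set s | (fun k => phi i k s) @ \oo --> f i s] `<=` N].
  by move=> i; have [_ [N [mN N0 NP]]] := hphi i; exists N.
exists (fun k i => phi i k), (\bigcup_i N i); split=> //.
- by move=> k i; exact: (hphi i).1.
- by apply: fin_bigcup_measurable => [|i _]; [exact: finite_finset|have [] := hN i].
- apply/negligibleP.
    by apply: fin_bigcup_measurable => [|i _]; [exact: finite_finset|have [] := hN i].
  have -> : \bigcup_i N i = \big[setU/set0]_(i < n) N i.
    apply/seteqP; split=> [s [i _ Ns]|s]; first by rewrite (bigD1 i) //=; left.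
    by elim/big_ind: _ => // [A B hA hB [/hA|/hB]//|i _ Ns]; exists i.
  elim/big_ind: _ => [||i _]; [exact: negligible_set0|exact: negligibleU|].
  by have [mN N0 _] := hN i; exact/negligibleP.
- move=> s nNs e e0.
  have /choice[K hK] : forall i, exists K, forall k, (K <= k)%N -> `|f i s - phi i k s| < e.
    move=> i; have : (fun k => phi i k s) @ \oo --> f i s.
      by apply: contrapT => h; apply: nNs; exists i => //; have [_ _] := hN i; apply.
    by move=> /cvgrPdist_lt/(_ _ e0)[K _ hK]; exists K => k /hK.
  exists (\max_i K i) => k hk i; apply: hK; apply: leq_trans hk; exact: leq_bigmax.
Qed.

Definition tuple_closed (E : set ('I_n -> X)) : Prop :=
  forall x, (forall e, 0 < e -> exists2 x', (forall i, `|x i - x' i| < e) & E x') -> E x.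

(** Off the null set [N], the tuple lies in the closed set [E] exactly when its simple
    approximations eventually come within each [1/(m+1)] of [E], a countable condition. Completeness
    of [mu] handles the part inside [N]. *)
Lemma measurable_tuple_closed (f : 'I_n -> Omega -> X) (E : set ('I_n -> X)) :
  complete_measure mu -> (forall i, strongly_measurable mu (f i)) ->
  tuple_closed E -> measurable [set s | E (f ^~ s)].
Proof.
move=> cmu /strongly_measurable_tuple[phi [N [sphi mN N0 cvphi]]] clE.
pose nearE m : set ('I_n -> X) :=
  [set x | exists2 x', (forall i, `|x i - x' i| < m.+1%:R^-1) & E x'].
pose S := [set s | forall m, exists K, forall k, (K <= k)%N -> nearE m (phi k ^~ s)].
have mS : measurable S.
  apply: measurable_forall => m; apply: measurable_exists => K.
  apply: measurable_forall => k; apply: measurable_implies => _.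
  exact: (@measurable_simple_tuple (phi k)).
have ES s : ~ N s -> E (f ^~ s) <-> S s.
  move=> nN; split=> [Es m|Ss].
    have [|K hK] := cvphi s nN m.+1%:R^-1; first by rewrite invr_gt0.
    by exists K => k /hK h; exists (f ^~ s) => // i; rewrite distrC.
  apply: clE => e e0; have e20 : 0 < e / 2 by rewrite divr_gt0.
  have [K hK] := cvphi s nN _ e20.
  have /cvgrPdist_lt/(_ _ e20)[m _ /(_ m (leqnn m))] := @cvg_harmonic R.
  rewrite /= /harmonic sub0r normrN gtr0_norm ?invr_gt0 // => me.
  have [K' /(_ (maxn K K') (leq_maxr _ _))[x' hx' Ex']] := Ss m.
  exists x' => // i; have := hK (maxn K K') (leq_maxl _ _) i.
  have := hx' i; have := ler_distD (phi (maxn K K') i s) (f i s) (x' i).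
  by move: me; move: (_^-1) => u; lra.
have -> : [set s | E (f ^~ s)] = (S `\` N) `|` ([set s | E (f ^~ s)] `&` N).
  apply/seteqP; split=> s /=.
    by move=> Es; have [Ns|nNs] := pselect (N s); [right|left; split => //; apply/ES].
  by move=> [[Ss nNs]|[]//]; apply/ES.
by apply: measurableU; [exact: measurableD|exact: (cmu N)].
Qed.

End StronglyMeasurableTuples.

(* "The outer measure of [A] exceeds [c]": [A] need not be measurable. *)
Definition outer_gt {d} {T : measurableType d} {R : realType}
    (mu : set T -> \bar R) (c : \bar R) (A : set T) : Prop :=
  forall B, measurable B -> A `<=` B -> (c < mu B)%E.

(** Continuity from below for outer measure: if each [A j] had a measurable cover [B j] of measure
    at most [c], the tail intersections [C j] would be increasing covers, and their union would have
    measure at most [c]. *)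
Lemma outer_gt_bigcup {d} {T : measurableType d} {R : realType}
    (mu : {measure set T -> \bar R}) (c : \bar R) (A : nat -> set T) :
  (forall i j, (i <= j)%N -> A i `<=` A j) -> outer_gt mu c (\bigcup_j A j) ->
  exists j, outer_gt mu c (A j).
Proof.
move=> Amono big; apply: contrapT => nj.
have /choice[B hB] : forall j, exists B, [/\ measurable B, A j `<=` B & (mu B <= c)%E].
  move=> j; apply: contrapT => nB; apply: nj; exists j => B mB AB.
  by rewrite ltNge; apply/negP => le; apply: nB; exists B.
pose C j := \bigcap_(i in [set i | (j <= i)%N]) B i.
have mC j : measurable (C j).
  by apply: bigcap_measurableType => i _; have [] := hB i.
have mUC : measurable (\bigcup_j C j) by exact: bigcupT_measurable.
have : (c < mu (\bigcup_j C j))%E.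
  apply: big => // s [j _ Aj]; exists j => // i /= ji.
  by have [_ + _] := hB i; apply; exact: Amono Aj.
rewrite ltNge => /negP; apply.
have Cmono : nondecreasing_seq C.
  move=> i j ij; apply/subsetPset => s Cs l /= jl; apply: Cs => /=.
  exact: leq_trans jl.
have cv := @nondecreasing_cvg_mu _ _ _ mu _ mC mUC Cmono.
rewrite -(cvg_lim (@ereal_hausdorff R) cv); apply: lime_le.
  by apply/cvg_ex; eexists; exact: cv.
apply: nearW => j /=; have [mB _] := hB j; apply: le_trans.
by apply: le_measure; rewrite ?inE //; apply: bigcap_inf => /=.
Qed.

(** * Measurable selections *)

Section SimpleLimit.
Context {d} {Omega : measurableType d} {R : realType} {X : normedModType R}.

Lemma simple_fun_if (I : countType) (a : Omega -> I) (v : I -> X) (psi : Omega -> X) m :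
  (forall i, measurable [set s | a s = i]) -> simple_fun psi ->
  simple_fun (fun s => if (pickle (a s) <= m)%N then v (a s) else psi s).
Proof.
move=> ma [finpsi mpsi]; split.
- apply: (@sub_finite_set _ _
    ((fun l => if unpickle l is Some i then v i else 0) @` [set l | (l < m.+1)%N] `|`
     range psi)).
    move=> _ [s _ <-]; case: (leqP (pickle (a s)) m) => am; [left|right]; last by exists s.
    by exists (pickle (a s)) => //=; rewrite pickleK.
  by rewrite finite_setU; split=> //; apply: finite_image; exact: finite_II.
- move=> x.
  have -> : (fun s => if (pickle (a s) <= m)%N then v (a s) else psi s) @^-1` [set x] =
    [set s | exists i, [set s | (if (pickle i <= m)%N then v i = x else psi s = x)] s /\
      [set s | a s = i] s].
    apply/seteqP; split=> s /=.
      by move=> h; exists (a s); split => //; move: h; case: ifP.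
    by move=> [i [+ ai]]; rewrite ai; case: leqP.
  apply: measurable_exists => i; apply: measurableI => //.
  by case: leqP => _; [exact: measurable_const|exact: mpsi].
Qed.

(* The [m]-th approximation uses the last of the first [m] functions whose value at the
   point has a code at most [m]. *)
Lemma strongly_measurable_limit (mu : {measure set Omega -> \bar R}) (I : countType)
    (c : nat -> Omega -> I) (v : I -> X) (g : Omega -> X) :
  (forall k i, measurable [set s | c k s = i]) ->
  {ae mu, forall s, (fun k => v (c k s)) @ \oo --> g s} -> strongly_measurable mu g.
Proof.
move=> mc cvg_g.
pose fix h m k : Omega -> X := if k is k'.+1
  then fun s => if (pickle (c k s) <= m)%N then v (c k s) else h m k' s else fun=> 0.
have sh m k : simple_fun (h m k).
  elim: k => [|k IHk]; last exact: simple_fun_if.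
  split=> [|x]; first by apply: (sub_finite_set (B := [set 0])) => // _ [s _ <-].
  exact: (measurable_const (0 = x)).
exists (fun m => h m m); split=> //.
apply: filterS cvg_g => s /cvgrPdist_lt cvs; apply/cvgrPdist_lt => e e0.
have [K _ hK] := cvs e e0.
(* Once [m] reaches the code of [c K.+1 s], the downward search stops at index [K.+1] at the latest,
   so the value used is already close to the limit. *)
have hval m k : (K < k)%N -> (pickle (c K.+1 s) <= m)%N ->
    exists2 k', (K <= k')%N & h m k s = v (c k' s).
  elim: k => // k IHk Kk cm /=; case: leqP => [_|ck].
    by exists k.+1 => //; exact: ltnW.
  move: Kk; rewrite ltnS leq_eqVlt => /orP[/eqP Kk|Kk]; last exact: IHk.
  by move: ck; rewrite -Kk ltnNge cm.
exists (maxn K.+1 (pickle (c K.+1 s))) => // m; rewrite /= geq_max => /andP[Km cm].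
by have [k' Kk' ->] := hval m m Km cm; exact: hK.
Qed.

(** The values of the simple approximations are countably many and come close to the tuple almost
    everywhere; [q] enumerates them. *)
Lemma strongly_measurable_dense n (mu : {measure set Omega -> \bar R})
    (f : 'I_n -> Omega -> X) :
  (forall i, strongly_measurable mu (f i)) ->
  exists (N : set Omega) (q : nat -> 'I_n -> X), [/\ measurable N, mu N = 0%E &
    forall s, ~ N s -> forall e, 0 < e -> exists l, forall i, `|f i s - q l i| < e].
Proof.
move=> /strongly_measurable_tuple[phi [N [sphi mN N0 cvphi]]].
have /choice[r hr] : forall ki : nat * 'I_n,
    exists r : seq X, range (phi ki.1 ki.2) = [set` r].
  by move=> ki; have [/finite_seqP] := sphi ki.1 ki.2.
pose q l i := if unpickle l is Some kt then
  nth 0 (r (kt.1, i)) ((kt.2 : {ffun 'I_n -> nat}) i) else 0.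
exists N, q; split=> // s /cvphi cvs e /cvs[K /(_ K (leqnn K)) hK].
exists (pickle (K, [ffun i => index (phi K i s) (r (K, i))])) => i.
rewrite /q pickleK /= ffunE nth_index //.
have : range (phi K i) (phi K i s) by exists s.
by rewrite (hr (K, i)).
Qed.

End SimpleLimit.

(** Always taking the least admissible successor makes the branch depend measurably on the point,
    since each choice is decided by countably many of the sets [S t]. *)
Lemma measurable_tree_selection {d} {Omega : measurableType d} (S : seq nat -> set Omega) :
  (forall t, measurable (S t)) ->
  (forall t s, S t s -> exists j, S (rcons t j) s) ->
  exists c : Omega -> nat -> nat,
    (forall s, S [::] s -> forall m, S (mkseq (c s) m) s) /\
    (forall m t, measurable [set s | mkseq (c s) m = t]).
Proof.
move=> mS subS.
pose least t s j := S (rcons t j) s /\ forall i, (i < j)%N -> ~ S (rcons t i) s.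
(* The default [0] where no successor exists keeps the branch defined, and its prefixes measurable,
   on all of [Omega]. *)
pose spec t s j := least t s j \/ (j = 0%N /\ forall i, ~ S (rcons t i) s).
have /choice[nx hnx] : forall ts : seq nat * Omega, exists j, spec ts.1 ts.2 j.
  move=> [t s] /=; have [hS|nS] := pselect (exists j, S (rcons t j) s); last first.
    by exists 0%N; right; split=> // i Si; apply: nS; exists i.
  have hS' : exists j, `[< S (rcons t j) s >] by case: hS => j ?; exists j; apply/asboolP.
  case: (ex_minnP hS') => j /asboolP Sj jmin; exists j; left; split=> // i ij Si.
  by have := jmin i; rewrite leqNgt ij => /(_ (asboolT Si)).
have specU t s j j' : spec t s j -> spec t s j' -> j = j'.
  move=> [[Sj mj]|[-> nS]] [[Sj' mj']|[-> nS']] //.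
  - by case: (ltngtP j j') => // [/mj'|/mj].
  - by have := nS' j Sj.
  - by have := nS j' Sj'.
pose T s m := iter m (fun t => rcons t (nx (t, s))) [::].
pose c s m := nx (T s m, s).
have cT s m : mkseq (c s) m = T s m by elim: m => // m IHm; rewrite mkseqS IHm.
exists c; split=> [s S0 m|m t].
- rewrite cT; elim: m => // m /subS[j Sj] /=.
  by have [[]|[_ /(_ j)]] := hnx (T s m, s).
- elim: m t => [|m IHm] t; first exact: (measurable_const ([::] = t)).
  have -> : [set s | mkseq (c s) m.+1 = t] =
      [set s | exists tj : seq nat * nat, [set s | rcons tj.1 tj.2 = t] s /\
        ([set s | mkseq (c s) m = tj.1] s /\ [set s | spec tj.1 s tj.2] s)].
    apply/seteqP; split=> s /=; rewrite mkseqS.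
      move=> <-; exists (mkseq (c s) m, c s m); split=> //=; split=> //.
      by rewrite {1}cT; exact: (hnx (T s m, s)).
    move=> [[t' j] /= [<- [ct' sj]]]; congr rcons => //.
    by apply: (specU t' s) sj; rewrite -ct' cT; exact: (hnx (T s m, s)).
  apply: measurable_exists => -[t' j]; apply: measurableI; first exact: measurable_const.
  apply: measurableI; first exact: IHm.
  have mN i : measurable (~` S (rcons t' i)) by exact: measurableC.
  apply: measurableU; apply: measurableI.
  - exact: mS.
  - by apply: measurable_forall => i; apply: measurable_implies => _; exact: mN.
  - exact: measurable_const.
  - by apply: measurable_forall => i; exact: mN.
Qed.

(** [Z] is the norm closure of the rational combinations of the [y i]: a closed subspace, hence
    weakly closed. *)
Lemma separable_weakly_closed {R : realType} {X : normedModType R} (y : nat -> X) :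
  exists (Z : set X) (z : nat -> X), [/\ forall i, Z (y i), weakly_open (~` Z) &
    forall x, Z x -> forall e, 0 < e -> exists j, `|x - z j| < e].
Proof.
pose comb (L : seq (rat * nat)) : X := \sum_(a <- L) ratr a.1 *: y a.2.
have comb_cat L M : comb (L ++ M) = comb L + comb M by exact: big_cat.
have combZ a L : ratr a *: comb L = comb [seq (a * b.1, b.2) | b <- L].
  rewrite /comb big_map scaler_sumr; apply: eq_bigr => b _ /=.
  by rewrite scalerA rmorphM.
pose Z : set X := [set x | forall e, 0 < e -> exists L, `|x - comb L| < e].
have combZ' L : Z (comb L) by move=> e e0; exists L; rewrite subrr normr0.
exists Z, (fun j => comb (odflt [::] (unpickle j))); split.
- move=> i; have := combZ' [:: (1, i)]; rewrite /comb big_seq1 /=.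
  by rewrite rmorph1 scale1r.
- apply: weakly_open_setC_subspace; last first.
    move=> x hx e e0; have e20 : 0 < e / 2 by rewrite divr_gt0.
    have [x' /(_ _ e20)[L hL] hx'] := hx _ e20; exists L.
    by have := ler_distD x' x (comb L); lra.
  split; first by have := combZ' [::]; rewrite /comb big_nil.
  move=> a u w Zu Zw e e0.
  have [L hL] : exists L, `|a *: u - comb L| < e / 2.
    (* One quarter of [e] pays for replacing [a] by a rational [r], another for replacing [u] by a
       combination; adding [1] avoids a zero denominator. *)
    have d0 : 0 < e / 4 / (1 + `|u|) by rewrite !divr_gt0 // ltr_pwDl.
    have [|r] := @rat_in_itvoo _ (a - e / 4 / (1 + `|u|)) a; first by lra.
    rewrite in_itv /= => /andP[r1 r2].
    have f0 : 0 < e / 4 / (1 + `|ratr r : R|) by rewrite !divr_gt0 // ltr_pwDl.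
    have [L hL] := Zu _ f0; exists [seq (r * b.1, b.2) | b <- L]; rewrite -combZ.
    have := ler_distD (ratr r *: u) (a *: u) (ratr r *: comb L).
    rewrite -scalerBl -scalerBr (normrZ (a - ratr r)) (normrZ (ratr r : R)).
    have h1 : `|a - ratr r| * `|u| <= e / 4.
      rewrite gtr0_norm ?subr_gt0 //.
      have : a - ratr r <= e / 4 / (1 + `|u|) by lra.
      rewrite ler_pdivlMr ?ltr_pwDl //; apply: le_trans.
      by rewrite ler_wpM2l ?lerDr // subr_ge0 ltW.
    have h2 : `|ratr r : R| * `|u - comb L| < e / 4.
      have : (1 + `|ratr r : R|) * `|u - comb L| < e / 4.
        by rewrite mulrC -ltr_pdivlMr // ltr_pwDl.
      apply: le_lt_trans; apply: ler_wpM2r => //; lra.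
    lra.
  have [M hM] := Zw (e / 2) (ltac:(by rewrite divr_gt0)).
  exists (L ++ M); rewrite comb_cat opprD addrACA.
  by apply: le_lt_trans (ler_normD _ _) _; lra.
- by move=> x Zx e /Zx[L hL]; exists (pickle L); rewrite pickleK.
Qed.

(** Minimality passes to the limit by continuity. Membership in [Y] comes from proximinality applied
    to the constant tuple [y]: as [Y] contains points arbitrarily close to [y], a center of that
    tuple must equal [y]. *)
Lemma centers_closed {R : realType} {X : normedModType R} (p : R) n (Y : set X)
    (x : 'I_n -> X) (y : X) :
  0 < p -> (0 < n)%N -> simul_proximinal p n Y ->
  (forall e, 0 < e -> exists2 w, centers p Y x w & `|y - w| < e) -> centers p Y x y.
Proof.
move=> p0 n0 prox hy.
have min z : Y z -> shifted_sum p x y 0 <= shifted_sum p x z 0.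
  move=> Yz; rewrite leNgt; apply/negP => h.
  have [e e0] := shifted_sum_gtB p0 h; apply/negP; rewrite -leNgt.
  have [w [_ wmin] yw] := hy e e0; apply: le_trans (wmin z Yz).
  by apply: le_shifted_sum => // i; have := ler_distD w (x i) y; rewrite [`|w - y|]distrC; lra.
split=> //; have [y0 Yy0 y0min] := prox (fun=> y).
suff -> : y = y0 by [].
apply/eqP; rewrite -subr_eq0 -normr_le0 leNgt; apply/negP => y0y.
have [w [Yw _] yw] := hy _ y0y.
have := y0min w Yw; apply/negP; rewrite -ltNge.
have -> : \sum_(i < n) `|y - w| `^ p = n%:R * `|y - w| `^ p.
  by rewrite sumr_const card_ord mulr_natl.
have -> : \sum_(i < n) `|y - y0| `^ p = n%:R * `|y - y0| `^ p.
  by rewrite sumr_const card_ord mulr_natl.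
by rewrite ltr_pM2l ?ltr0n //; apply: gt0_ltr_powR => //; rewrite nnegrE.
Qed.

(** * Selection of centers *)

Section Selection.
Context {R : realType} {X : completeNormedModType R} {d : measure_display}
  {Omega : measurableType d} (mu : probability Omega R) (p : R) (n : nat) (Y : set X)
  (Psi : (nat -> nat) -> set X) (f : 'I_n -> Omega -> X).
Hypotheses (cmu : complete_measure mu) (p0 : 0 < p) (n0 : (0 < n)%N)
  (prox : simul_proximinal p n Y)
  (PsiK : forall s, Psi s !=set0 /\ weakly_compact (Psi s)) (PsiU : usc_map Psi)
  (YPsi : Y = \bigcup_s Psi s) (mf : forall i, strongly_measurable mu (f i)).

Local Notation full k := [set u : nat -> nat | forall i, (u i <= k i)%N].
Local Notation box k M := [set u : nat -> nat | forall i, (i < M)%N -> (u i <= k i)%N].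

Let PsiY s : Psi s `<=` Y.
Proof. by move=> y sy; rewrite YPsi; exists s. Qed.

Let oT : weakly_open (~` [set: X]).
Proof. by move=> x nT; exfalso; exact: nT. Qed.

Lemma centers_nonempty (x : 'I_n -> X) : centers p Y x !=set0.
Proof.
have [y0 Yy0 hy0] := prox x; exists y0; split=> // z Yz.
by rewrite !shifted_sum0; exact: hy0.
Qed.

Lemma centered_closed k C : weakly_open (~` C) ->
  tuple_closed (centered (n := n) p Y Psi (full k) C).
Proof.
move=> oC x hx; apply: centered_limit => //.
- by move=> s; have [] := PsiK s.
- exact: centers_nonempty.
- move=> M e /hx[x' xx' [u [y [uk uy Cy cy]]]]; exists x' => //.
  by exists u, y; split=> // i _; exact: uk.
Qed.

Lemma measurable_centered k C : weakly_open (~` C) ->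
  measurable [set s | centered p Y Psi (full k) C (f ^~ s)].
Proof. by move=> oC; apply: (measurable_tuple_closed cmu mf); exact: centered_closed. Qed.

(* The sets where some center lies in [Psi (box k m)] need not be measurable: each of
   them is replaced by the preimage of the closure of the corresponding set of tuples,
   and by compactness the intersection of these closures is not too large. *)
Lemma measure_centered (c : R) : c < 1 ->
  exists k, (c%:E <= mu [set s | centered p Y Psi (full k) setT (f ^~ s)])%E.
Proof.
move=> c1.
pose A t := [set s | centered p Y Psi
  [set u | forall i, (i < size t)%N -> (u i <= nth 0 t i)%N] setT (f ^~ s)].
(* The bounds [k i] are chosen one at a time: letting the next bound grow exhausts the current set,
   so some value keeps the outer measure above [c]. *)
have [||k hk] := @seq_dependent_choice (fun t => outer_gt mu c%:E (A t)).
- move=> B mB AB; suff -> : B = setT by rewrite probability_setT lte_fin.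
  apply/seteqP; split=> // s _; apply: AB.
  have [y cy] := centers_nonempty (f ^~ s).
  by have := cy.1; rewrite {1}YPsi => -[u _ uy]; exists u, y; split.
- move=> t ht; apply: outer_gt_bigcup.
    move=> i j ij s [u [y [ut uy Cy cy]]]; exists u, y; split=> // l.
    have := ut l; rewrite !size_rcons !nth_rcons => + lt => /(_ lt).
    case: ltnP => // _; case: eqP => // _ ul; exact: leq_trans ij.
  move=> B mB AB; apply: ht => // s [u [y [ut uy Cy cy]]]; apply: AB.
  exists (u (size t)) => //; exists u, y; split=> // l /=.
  rewrite size_rcons ltnS nth_rcons; case: ltngtP => // [lt _|-> _]; last by [].
  exact: ut.
exists k.
pose E m : set ('I_n -> X) := [set x | forall e, 0 < e ->
  exists2 x', (forall i, `|x i - x' i| < e) & centered p Y Psi (box k m) setT x'].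
pose G m := [set s | E m (f ^~ s)].
have clE m : tuple_closed (E m).
  move=> x hx e e0; have e20 : 0 < e / 2 by rewrite divr_gt0.
  have [x' xx' /(_ _ e20)[x2 hx2 cx2]] := hx _ e20; exists x2 => // i.
  by have := xx' i; have := hx2 i; have := ler_distD (x' i) (x i) (x2 i); lra.
have mG m : measurable (G m) by exact: (measurable_tuple_closed cmu mf).
have Gc m : (c%:E <= mu (G m))%E.
  apply/ltW/(hk m) => // s [u [y [ut uy Cy cy]]] e e0; exists (f ^~ s).
    by move=> i; rewrite subrr normr0.
  exists u, y; split=> // i im; have := ut i.
  by rewrite size_mkseq nth_mkseq //; apply.
have mIG : measurable (\bigcap_m G m) by exact: bigcapT_measurable.
have Gmono : nonincreasing_seq G.
  move=> i j ij; apply/subsetPset => s Gs e /Gs[x' xx' [u [y [ut uy Cy cy]]]].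
  exists x' => //; exists u, y; split=> // l li; apply: ut; exact: leq_trans li ij.
have cv := @nonincreasing_cvg_mu _ _ _ mu _
  (le_lt_trans (probability_le1 mu (mG 0%N)) (ltry 1)) mG mIG Gmono.
apply: (@le_trans _ _ (mu (\bigcap_m G m))).
  rewrite -(cvg_lim (@ereal_hausdorff R) cv); apply: lime_ge.
    by apply/cvg_ex; eexists; exact: cv.
  by apply: nearW => m; exact: Gc.
apply: le_measure; rewrite ?inE //; first exact: measurable_centered.
move=> s Gs; apply: centered_limit => //.
- by move=> t; have [] := PsiK t.
- exact: centers_nonempty.
- by move=> M e; exact: (Gs M I e).
Qed.

(** For each approximating tuple [q l] and each [m], one center is recorded of some tuple within
    [1/(m+1)] of [q l], when there is one in the box. With [Z] generated by these centers, almost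
    every tuple with a center in the box is a limit of tuples centered in [Z], and [centered_closed]
    applies. *)
Lemma separable_centered k : exists (Z : set X) (z : nat -> X) (N : set Omega),
  [/\ weakly_open (~` Z), forall x, Z x -> forall e, 0 < e -> exists j, `|x - z j| < e,
      measurable N, mu N = 0%E & forall s, ~ N s ->
        centered p Y Psi (full k) setT (f ^~ s) ->
        centered p Y Psi (full k) Z (f ^~ s)].
Proof.
have [N [q [mN N0 hq]]] := strongly_measurable_dense mf.
pose good (lm : nat * nat) y := exists x u,
  [/\ forall i, `|q lm.1 i - x i| < lm.2.+1%:R^-1, full k u, Psi u y & centers p Y x y].
have /choice[y hy] : forall l, exists y, forall lm, unpickle l = Some lm ->
    (exists y, good lm y) -> good lm y.
  move=> l; case: unpickle => [lm|]; last by exists 0.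
  have [[y gy]|ng] := pselect (exists y, good lm y).
    by exists y => _ [<-].
  by exists 0 => _ [<-] /ng.
have [Z [z [Zy oZ Zz]]] := separable_weakly_closed y.
exists Z, z, N; split=> // s nN [u0 [y0 [u0k u0y _ cy0]]].
apply: (centered_closed oZ) => e e0.
have e20 : 0 < e / 2 by rewrite divr_gt0.
have /cvgrPdist_lt/(_ _ e20)[m _ /(_ m (leqnn m))] := @cvg_harmonic R.
rewrite /= /harmonic sub0r normrN gtr0_norm ?invr_gt0 // => me.
have [|l hl] := hq s nN m.+1%:R^-1; first by rewrite invr_gt0.
have glm : exists y, good (l, m) y.
  by exists y0, (f ^~ s), u0; split=> // i /=; rewrite distrC.
have [x [u [qx uk uy cy]]] := hy (pickle (l, m)) (l, m) (pickleK _) glm.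
exists x; last by exists u, (y (pickle (l, m))); split.
move=> i; have := qx i; have := hl i; have := ler_distD (q l i) (f i s) (x i).
by move: me => /=; move: (_^-1) => r; lra.
Qed.

(** A branch of the tree first picks a box, then balls of radii [1/(i+1)] such that any finitely
    many share a center. The midpoints are Cauchy, and their limit is a center by
    [centers_closed]. *)
Lemma measurable_centers_selection : exists2 g : Omega -> X,
  strongly_measurable mu g & forall s, centers p Y (f ^~ s) (g s).
Proof.
have /choice[k hk] : forall j : nat, exists k, ((1 - j.+1%:R^-1 : R)%:E <=
    mu [set s | centered p Y Psi (full k) setT (f ^~ s)])%E.
  by move=> j; apply: measure_centered; rewrite ltrBlDr ltrDl invr_gt0.
have /choice[Z /choice[z /choice[N hZ]]] := fun j => separable_centered (k j).
pose C j t : set X := [set y | Z j y /\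
  forall i, (i < size t)%N -> `|z j (nth 0%N t i) - y| <= i.+1%:R^-1].
have oC j t : weakly_open (~` C j t).
  elim/last_ind: t => [|t l IHt].
    suff -> : C j [::] = Z j by have [] := hZ j.
    by apply/seteqP; split=> [y [//]|y Zy]; split.
  have -> : C j (rcons t l) = C j t `&` [set y | `|z j l - y| <= (size t).+1%:R^-1].
    apply/seteqP; split=> y.
      move=> [Zy hy]; split; last first.
        by have := hy (size t); rewrite size_rcons nth_rcons ltnn eqxx; apply.
      split=> // i it; have := hy i; rewrite size_rcons nth_rcons it; apply.
      exact: ltnW.
    move=> [[Zy hy] /= hl]; split=> // i; rewrite size_rcons ltnS nth_rcons.
    by case: ltngtP => // [it _|-> _]; [exact: hy|].
  by rewrite setCI; apply: weakly_openU => //; exact: weakly_open_setC_ball.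
pose S t : set Omega := if t is j :: t'
  then [set s | centered p Y Psi (full (k j)) (C j t') (f ^~ s)]
  else [set s | exists j, [set s | centered p Y Psi (full (k j)) (C j [::]) (f ^~ s)] s].
have mS t : measurable (S t).
  case: t => [|j t]; last exact: measurable_centered.
  by apply: measurable_exists => j; exact: measurable_centered.
have subS t s : S t s -> exists j, S (rcons t j) s.
  case: t => [//|j t [u [y [uk uy [Zy hy] cy]]]].
  have [_ Zz _ _ _] := hZ j.
  have [|l hl] := Zz y Zy (size t).+1%:R^-1; first by rewrite invr_gt0.
  exists l; exists u, y; split=> //; split=> // i.
  rewrite size_rcons ltnS nth_rcons; case: ltngtP => // [it _|-> _]; first exact: hy.
  by rewrite distrC ltW.
have [c [cS mc]] := measurable_tree_selection mS subS.
pose v (t : seq nat) := z (head 0%N t) (last 0%N t).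
(* Entry [0] is the index of the box, so length [m.+2] makes ball number [m] the last entry. *)
pose w m s := mkseq (c s) m.+2.
have S0cvg s : S [::] s ->
    exists2 y, centers p Y (f ^~ s) y & (fun m => v (w m s)) @ \oo --> y.
  move=> S0s; have cSs := cS s S0s.
  have vw m : v (w m s) = z (c s 0%N) (c s m.+1).
    have E : last 0%N (w m s) = c s m.+1 by rewrite /w mkseqS last_rcons.
    by rewrite /v E.
  (* The common center may depend on [m]; the Cauchy estimate only compares two balls at a time. *)
  have approx m : exists2 y, centers p Y (f ^~ s) y &
      forall i, (i <= m)%N -> `|v (w i s) - y| <= i.+1%:R^-1.
    have := cSs m.+2.
    have -> : mkseq (c s) m.+2 = c s 0%N :: mkseq (fun i => c s i.+1) m.+1.
      by rewrite /mkseq -[iota 0 m.+2]/(0%N :: iota (1 + 0) m.+1) iotaDl /= -map_comp.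
    move=> [u [y [_ _ [_ hy] cy]]]; exists y => // i im.
    by have := hy i; rewrite size_mkseq nth_mkseq // vw; apply.
  have /cvg_ex[y cvy] : cvg ((fun m => v (w m s)) @ \oo).
    apply/cauchy_cvgP/cauchy_exP => e e0; have e20 : 0 < e / 2 by rewrite divr_gt0.
    have /cvgrPdist_lt/(_ _ e20)[K _ /(_ K (leqnn K))] := @cvg_harmonic R.
    rewrite /= /harmonic sub0r normrN gtr0_norm ?invr_gt0 // => Ke.
    exists (v (w K s)), K => // m /= Km.
    have [y _ hy] := approx m; have h1 := hy K Km; have h2 := hy m (leqnn m).
    have h3 : m.+1%:R^-1 <= K.+1%:R^-1 :> R by rewrite lef_pV2 ?posrE // ler_nat.
    rewrite -ball_normE /=; have := ler_distD y (v (w K s)) (v (w m s)).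
    rewrite [`|y - _|]distrC; move: Ke h1 h2 h3.
    by move: (m.+1%:R^-1) (K.+1%:R^-1) => r1 r2; lra.
  exists y => //; apply: (centers_closed p0 n0 prox) => e e0.
  have e20 : 0 < e / 2 by rewrite divr_gt0.
  have /cvgrPdist_lt/(_ _ e20)[m1 _ hm1] := @cvg_harmonic R.
  have /cvgrPdist_lt/(_ _ e20)[m2 _ hm2] := cvy.
  pose m := maxn m1 m2.
  have := hm1 m (leq_maxl _ _); have := hm2 m (leq_maxr _ _).
  rewrite /= /harmonic sub0r normrN gtr0_norm ?invr_gt0 // => h2 h1.
  have [y' cy' /(_ m (leqnn m)) hy'] := approx m; exists y' => //.
  have := ler_distD (v (w m s)) y y'; move: h1 h2 hy'; move: (_^-1) => r; lra.
(* Outside [S [::]], a null set, any center is taken, so that [g s] is a center for every [s]. *)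
have /choice[g hg] : forall s, exists y, centers p Y (f ^~ s) y /\
    (S [::] s -> (fun m => v (w m s)) @ \oo --> y).
  move=> s; have [/S0cvg[y cy cvy]|nS] := pselect (S [::] s); first by exists y.
  by have [y cy] := centers_nonempty (f ^~ s); exists y; split.
exists g; last by move=> s; exact: (hg s).1.
apply: (@strongly_measurable_limit _ _ _ _ mu _ w v) => [m t|]; first exact: mc.
exists (~` S [::]); split; [exact: measurableC| |].
- apply: (eq_trans (probability_setC mu (mS [::]))).
  suff -> : mu (S [::]) = 1%E by rewrite subee.
  apply/eqP; rewrite eq_le (probability_le1 mu (mS [::])) /=.
  (* Box [k j] already reaches this measure, and restricting centers to [Z j] loses only the null
     set [N j]. *)
  have hj j : ((1 - j.+1%:R^-1 : R)%:E <= mu (S [::]))%E.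
    have [_ _ mN N0 hN] := hZ j.
    apply: le_trans (hk j) _; rewrite -[leRHS]adde0 -N0.
    apply: le_trans (measureU2 _ _ _) => //.
    apply: le_measure; rewrite ?inE; first exact: measurable_centered.
      exact: measurableU.
    move=> s hs; have [Ns|nNs] := pselect (N j s); [by right|left].
    exists j; have [u [y [uk uy Zy cy]]] := hN s nNs hs.
    by exists u, y; split=> //; split.
  move: hj; rewrite -(fineK (fin_num_measure mu _ (mS [::]))).
  move: (fine _) => r hj; rewrite lee_fin; apply/ler_addgt0Pr => e e0.
  have /cvgrPdist_lt/(_ _ e0)[m _ /(_ m (leqnn m))] := @cvg_harmonic R.
  rewrite /= /harmonic sub0r normrN gtr0_norm ?invr_gt0 // => me.
  by have := hj m; rewrite lee_fin; move: me; move: (_^-1) => q; lra.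
- by move=> s; apply: contra_not => Ss; exact: (hg s).2.
Qed.

End Selection.

(** * Integrals of powers of norms *)

Section NormPowers.
Context {R : realType} {X : normedModType R} {d : measure_display}
  {Omega : measurableType d} (mu : {measure set Omega -> \bar R}) (p : R).

Lemma strongly_measurable_cst (x : X) : strongly_measurable mu (fun=> x).
Proof.
exists (fun _ _ => x); split=> [_|].
  split=> [|y]; last exact: (measurable_const (x = y)).
  by apply: (sub_finite_set (B := [set x])) => // _ [s _ <-].
by apply: aeW => s; exact: cvg_cst.
Qed.

(** The condition [r <= |f s - g s|] is closed in the pair, viewed as a tuple indexed by ['I_2]. *)
Lemma measurable_norm_sub (f g : Omega -> X) : complete_measure mu ->
  strongly_measurable mu f -> strongly_measurable mu g ->
  measurable_fun setT (fun s => `|f s - g s|).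
Proof.
move=> cmu mf mg; apply: (measurability _ (RGenCInfty.measurableE R)) => //.
move=> _ [_ [r ->] <-]; rewrite setTI.
pose F (i : 'I_2) := if i == ord0 then f else g.
have mF i : strongly_measurable mu (F i) by rewrite /F; case: ifP.
pose E : set ('I_2 -> X) := [set x | r <= `|x ord0 - x ord_max|].
have clE : tuple_closed E.
  move=> x hx; rewrite /E /= leNgt; apply/negP => xr.
  have e0 : 0 < (r - `|x ord0 - x ord_max|) / 2 by rewrite divr_gt0 // subr_gt0.
  have [x' hx' Ex'] := hx _ e0; rewrite /E /= in Ex'.
  have := hx' ord0; have := hx' ord_max.
  have := ler_distD (x ord0) (x' ord0) (x' ord_max).
  have := ler_distD (x ord_max) (x ord0) (x' ord_max).
  by rewrite [`|x' ord0 - x ord0|]distrC; lra.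
have := measurable_tuple_closed cmu mF clE.
suff -> : [set s | E (F ^~ s)] = (fun s => `|f s - g s|) @^-1` `[r, +oo[ by [].
by apply/seteqP; split=> s; rewrite /E /F /= in_itv /= andbT.
Qed.

Lemma measurable_norm_pow (f g : Omega -> X) : complete_measure mu ->
  strongly_measurable mu f -> strongly_measurable mu g ->
  measurable_fun [set: Omega] ((fun s => (`|f s - g s| `^ p)%:E) : Omega -> \bar R).
Proof.
move=> cmu mf mg; apply/measurable_EFinP.
apply: (measurableT_comp (measurable_powR p)); exact: measurable_norm_sub.
Qed.

Lemma sum_Lp_pow n (f : 'I_n -> Omega -> X) (g : Omega -> X) : complete_measure mu ->
  (forall i, strongly_measurable mu (f i)) -> strongly_measurable mu g ->
  (\sum_(i < n) Lp_pow mu p (fun s => (f i s - g s)%R) =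
   \int[mu]_s (\sum_(i < n) `|f i s - g s| `^ p)%:E)%E.
Proof.
move=> cmu mf mg; rewrite -ge0_integral_sum //.
- by apply: eq_integral => s _; rewrite sumEFin.
- by move=> i; exact: measurable_norm_pow.
Qed.

Lemma measurable_sum_norm_pow n (f : 'I_n -> Omega -> X) (g : Omega -> X) :
  complete_measure mu -> (forall i, strongly_measurable mu (f i)) ->
  strongly_measurable mu g ->
  measurable_fun [set: Omega]
    ((fun s => (\sum_(i < n) `|f i s - g s| `^ p)%:E) : Omega -> \bar R).
Proof.
move=> cmu mf mg; under eq_fun do rewrite -sumEFin.
by apply: emeasurable_sum => i; exact: measurable_norm_pow.
Qed.

End NormPowers.

(** Comparison with the competitor [0] bounds the powers of [|x i0|] and [|x i0 - y|] by the sum,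
    and [|y|] is at most twice the larger of these norms. This domination makes a selection of
    centers [p]-integrable. *)
Lemma norm_center_le {R : realType} {X : normedModType R} (p : R) n (Y : set X)
    (x : 'I_n -> X) (y : X) : 0 < p -> (0 < n)%N -> Y 0 -> centers p Y x y ->
  `|y| `^ p <= 2 `^ p * 2 * \sum_(i < n) `|x i - 0| `^ p.
Proof.
move=> p0 n0 Y0 [_ /(_ 0 Y0)]; rewrite !shifted_sum0; set S := (X in _ <= X) => hS.
pose i0 := Ordinal n0.
have bound z : `|x i0 - z| `^ p <= \sum_(i < n) `|x i - z| `^ p.
  by rewrite (bigD1 i0) //= lerDl sumr_ge0 // => i _; exact: powR_ge0.
have h1 : `|x i0| `^ p <= S by have := bound 0; rewrite subr0.
have h2 : `|x i0 - y| `^ p <= S := le_trans (bound y) hS.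
pose M := Num.max `|x i0| `|x i0 - y|.
have M0 : 0 <= M by rewrite le_max normr_ge0.
have hM : `|y| <= 2 * M.
  have := ler_distD (x i0) y 0; rewrite !subr0 distrC.
  have : `|x i0| <= M by rewrite le_max lexx.
  have : `|x i0 - y| <= M by rewrite le_max lexx orbT.
  lra.
have S0 : 0 <= S by apply: sumr_ge0 => i _; exact: powR_ge0.
apply: (@le_trans _ _ ((2 * M) `^ p)).
  by apply: ge0_ler_powR => //; rewrite ?nnegrE ?mulr_ge0 // ltW.
rewrite powRM // -mulrA ler_wpM2l ?powR_ge0 //.
by rewrite -/S /M maxEle; clearbody S; case: ifP => _; lra.
Qed.

(** * From pointwise centers to a minimizer of the integral *)

Theorem mainTheorem1 (R : realType) (X : completeNormedModType R)
  (d : measure_display) (Omega : measurableType d)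
  (mu : probability Omega R) (p : R) (n : nat) (Y : set X) :
  complete_measure mu -> 1 <= p -> (0 < n)%N ->
  vector_subspace Y -> weakly_K_analytic Y -> simul_proximinal p n Y ->
  forall f : 'I_n -> Omega -> X, (forall i, in_Lp mu p (f i)) ->
  exists2 g : Omega -> X, in_LpY mu p Y g &
    forall h : Omega -> X, in_LpY mu p Y h ->
      (\sum_(i < n) Lp_pow mu p (fun s => (f i s - g s)%R)
        <= \sum_(i < n) Lp_pow mu p (fun s => (f i s - h s)%R))%E.
Proof.
move=> cmu p1 n0 Ysub [Psi [PsiK PsiU YPsi]] prox f Lf.
have p0 : 0 < p by exact: lt_le_trans p1.
have mf i : strongly_measurable mu (f i) by have [] := Lf i.
have [g mg cg] := measurable_centers_selection cmu p0 n0 prox PsiK PsiU YPsi mf.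
have m0 := strongly_measurable_cst mu (0 : X).
exists g.
- split; last by move=> s; have [] := cg s.
  split=> //.
  pose c := 2 `^ p * 2 : R.
  have c0 : 0 <= c by rewrite mulr_ge0 ?powR_ge0.
  have sum0 : (\sum_(i < n) Lp_pow mu p (fun s => (f i s - 0)%R) < +oo)%E.
    apply: lte_sum_pinfty => i _; have [_] := Lf i; congr (_ < _)%E.
    by apply: eq_integral => s _; rewrite subr0.
  apply: (@le_lt_trans _ _ (c%:E * \sum_(i < n) Lp_pow mu p (fun s => (f i s - 0)%R))%E);
    last by rewrite lte_mul_pinfty ?lee_fin.
  rewrite (sum_Lp_pow p cmu mf m0) -ge0_integralZl //; first last.
  + by move=> s _; rewrite lee_fin sumr_ge0 // => i _; exact: powR_ge0.
  + exact: (measurable_sum_norm_pow p cmu mf m0).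
  apply: ge0_le_integral => //.
  + have := measurable_norm_pow p cmu mg m0.
    by congr (measurable_fun _ _); apply/funext => s; rewrite subr0.
  + apply: measurable_funeM; exact: (measurable_sum_norm_pow p cmu mf m0).
  + by move=> s _; rewrite -EFinM lee_fin; apply: (norm_center_le p0 n0 Ysub.1 (cg s)).
- move=> h [[mh _] Yh]; rewrite !(sum_Lp_pow p cmu mf) //.
  apply: ge0_le_integral => //.
  + by move=> s _; rewrite lee_fin sumr_ge0 // => i _; exact: powR_ge0.
  + exact: (measurable_sum_norm_pow p cmu mf mg).
  + exact: (measurable_sum_norm_pow p cmu mf mh).
  + move=> s _; rewrite lee_fin; have [_ /(_ (h s) (Yh s))] := cg s.
    by rewrite !shifted_sum0.
Qed.
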